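(* There exists $N_0\in\mathbb{N}$ such that the following holds for every $N\geq N_0$. Let $\gamma\in C^{N}(0,1]$ be a real-valued function that is monotonic on $(0,1]$ with $\lim_{t\rightarrow 0^+}\gamma(t)=0$. Suppose that: (a) there exist positive constants $C^{(1)}_{1},C^{(2)}_{1}$ such that $\left|\frac{t^{j}\gamma^{(j)}(t)}{\gamma(t)}\right|\geq C^{(j)}_{1}$ for all $t\in(0,1]$ and $j=1,2$; (b) there exist positive constants $C^{(1)}_{2},\dots,C^{(N)}_{2}$ such that $\left|\frac{t^{j}\gamma^{(j)}(t)}{\gamma(t)}\right|\leq C^{(j)}_{2}$ for all $t\in(0,1]$ and $1\leq j\leq N$. Let $\omega:=\limsup_{t\rightarrow 0^{+}}\frac{\ln|\gamma(t)|}{\ln t}$ and let $p,q\in[1,\infty]$. Suppose that there exists a positive constant $C$ such that for all $f\in L^{p}(\mathbb{R}^{2})$, $$\|Tf\|_{L^q_{x,u}(\mathbb{R}^2\times[1,2])}\leq C\|f\|_{L^p_x(\mathbb{R}^2)},$$ where $Tf(x,u):=\int_0^1 f(x_1-ut,\,x_2-u\gamma(t))\,dt$ for $x=(x_1,x_2)\in\mathbb{R}^2$ and $u\in[1,2]$. Then all of the following conditions hold: (i) $1+(1+\omega)\left(\frac1q-\frac1p\right)\geq 0$; (ii) $\frac2p-1\leq\frac1q\leq\frac1p$; (iii) $\frac1q\geq\frac1{3p}$; (iv) $\frac1q\geq\frac1p-\frac13$.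
   Context: For $x=(x_1,x_2)\in\mathbb{R}^2$ and $u\in[1,2]$, $T$ is the averaging operator along the dilated plane curve $(ut,u\gamma(t))$, $t\in(0,1]$. The norm $L^q_{x,u}(\mathbb{R}^2\times[1,2])$ is the $L^q$ norm with respect to Lebesgue measure in $(x,u)$. The quotients in (a) and (b) presuppose $\gamma(t)\neq 0$ for $t\in(0,1]$. Exponents range over $[1,\infty]$ with the convention $1/\infty=0$. *)

(* Defs.v *)
From HB Require Import structures.
From mathcomp Require Import all_boot all_order all_algebra.
From mathcomp Require Import all_classical all_reals all_analysis.

Set Implicit Arguments.
Unset Strict Implicit.
Unset Printing Implicit Defensive.

Import Order.TTheory GRing.Theory Num.Theory.
Import numFieldNormedType.Exports.

Local Open Scope classical_set_scope.
Local Open Scope ring_scope.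

Section derivatives_within.
Context {R : realType}.
Implicit Types (D : set R) (f : R -> R) (x y : R).

(* The library's ['D_v f] and [f^`()] are two-sided. Restricting the difference
   quotient to [y \in D] makes the derivative at an endpoint belonging to [D]
   (the point 1 of ]0, 1]) the one-sided one, and independent of the values of
   [f] outside [D]. *)
Definition diff_quot f x y : R := (f y - f x) / (y - x).

Definition derivable_within D f x : Prop :=
  cvg (diff_quot f x y @[y --> within D x^']).

Definition derive_within D f x : R :=
  lim (diff_quot f x y @[y --> within D x^']).

Definition derive_withinn D (n : nat) f : R -> R := iter n (derive_within D) f.

Definition Cn_on D (n : nat) f : Prop :=
  (forall j, (j < n)%N ->
     forall x, D x -> derivable_within D (derive_withinn D j f) x) /\
  {within D, continuous (derive_withinn D n f)}.

End derivatives_within.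

Section averaging_operator.
Context {R : realType}.

Definition lebesgue2 :
    {measure set (measurableTypeR R * measurableTypeR R) -> \bar R} :=
  (@lebesgue_measure R \x @lebesgue_measure R)%E.

Definition lebesgue3 : {measure set
    (measurableTypeR R * measurableTypeR R * measurableTypeR R) -> \bar R} :=
  (lebesgue2 \x @lebesgue_measure R)%E.

Lemma measurable_plane_itv12 :
  measurable ([set: measurableTypeR R * measurableTypeR R] `*`
              (`[1, 2] : set (measurableTypeR R))).
Proof. by apply: measurableX => //; exact: measurable_itv. Qed.

(* Lebesgue measure on R^2 x [1, 2], carried by the ambient type R^2 x R. *)
Definition lebesgue_plane_itv12 : {measure set
    (measurableTypeR R * measurableTypeR R * measurableTypeR R) -> \bar R} :=
  mrestr lebesgue3 measurable_plane_itv12.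

(* The integral is extended-real-valued: for [f] in L^p it converges absolutely
   for almost every [(x, u)]. *)
Definition curve_average (gamma : R -> R) (f : R * R -> R)
    (z : R * R * R) : \bar R :=
  let: (x, u) := z in
  (\int[@lebesgue_measure R]_(t in `]0%R, 1%R])
     (f (x.1 - u * t, x.2 - u * gamma t)%R)%:E)%E.

End averaging_operator.

(* 1/p for p in [1, +oo], with 1/oo = 0. *)
Definition inv_exponent (R : realType) (p : \bar R) : R := fine (p^-1)%E.

(* Main.v *)
(* Each condition comes from testing the inequality on the indicator of a set B.
   Here B is always a strip {|y1 - b| <= s1, |y2 - psi(y1)| <= s2} and the
   average of its indicator is at least l on a tube of points (x, u) of the same
   shape, so that l |tube|^(1/q) <= C |B|^(1/p):
   - (i): B a box of sides comparable to e and |gamma(e)|, with l = e;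
   - 1/q <= 1/p: B a box of side L -> oo, with l = 1;
   - 2/p - 1 <= 1/q: B a box of side d, the tube being the d-neighbourhood of the
     dilated curves (volume ~ d), with l = d;
   - (iii): B the d-neighbourhood of an arc of the reflected curve, the tube being
     a cube of side d around the point (0, 0, 1), with l = 1/2;
   - (iv): B a d x d^2 rectangle along the tangent at t = 1/2, the tube being its
     translates by the points u (1/2, gamma(1/2)) (volume ~ d^3), with l = d.
   Letting d -> 0 compares the exponents. *)

Require Import Defs.
From HB Require Import structures.
From mathcomp Require Import all_boot all_order all_algebra.
From mathcomp Require Import all_classical all_reals all_analysis.
From mathcomp Require Import ess_sup_inf measurable_realfun ring lra.

Import Order.TTheory GRing.Theory Num.Theory.
Import numFieldNormedType.Exports.

Local Open Scope classical_set_scope.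
Local Open Scope ring_scope.

(** * Norm estimates involving indicators *)

Section integral_lower_bound.
Import HBNNSimple.

(** The integral of a nonnegative function is the supremum of the integrals of the simple functions
    below it, and [c] times the indicator of [A] is one of these. Hence [g] may be any nonnegative
    function, in particular an average along [gamma]. *)
Lemma ge0_integral_ge_cst d (T : measurableType d) (R : realType)
    (mu : {measure set T -> \bar R}) (D A : set T) (g : T -> \bar R) (c : R) :
  measurable A -> A `<=` D -> 0 <= c -> (forall x, (0 <= g x)%E) ->
  (forall x, A x -> (c%:E <= g x)%E) ->
  (c%:E * mu A <= \int[mu]_(x in D) g x)%E.
Proof.
move=> mA AD c0 g0 cg.
rewrite ge0_integralE//; apply: ereal_sup_ubound => /=.
exists (scale_nnsfun (indic_nnsfun R mA) c0).
  move=> x; rewrite -[leLHS]/((c * \1_A x)%:E) indicE /patch.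
  have [xA|xA] := boolP (x \in A).
    by rewrite mulr1 ifT ?cg//; [exact/set_mem|exact/mem_set/AD/set_mem].
  by rewrite mulr0; case: ifP.
rewrite -[LHS]/(sintegral mu (cst c \* indic_nnsfun R mA)).
by rewrite sintegralrM sintegral_indic.
Qed.

End integral_lower_bound.

(** Chebyshev's inequality, with [m] standing for a lower bound of the measure of [A]. For finite
    [q] it follows by integrating [|g|^q >= c^q] over [A]; for [q = +oo] the positivity of [m] keeps
    [A] from being a null set. *)
Lemma Lnorm_ge_cst d (T : measurableType d) (R : realType)
    (mu : {measure set T -> \bar R}) (A : set T) (g : T -> \bar R) (q : \bar R)
    (c m : R) :
  (1 <= q)%E -> measurable A -> 0 < c -> 0 < m -> (m%:E <= mu A)%E ->
  (forall x, A x -> (c%:E <= g x)%E) ->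
  ((c * m `^ inv_exponent q)%:E <= 'N[mu]_q[g])%E.
Proof.
move=> q1 mA c0 m0 mmu cg; rewrite unlock /inv_exponent.
have cg' x : A x -> (c%:E <= `|g x|)%E.
  by move=> /cg/le_trans; apply; exact: lee_abs.
case: q q1 => [r r1|_|//]; last first.
- have muT : (0 < mu setT)%E.
    apply: (@lt_le_trans _ _ m%:E); first by rewrite lte_fin.
    by apply: (le_trans mmu); apply: le_measure; rewrite ?inE.
  (* Here 1/q = 0, so the factor [m] disappears. If the essential supremum were below [c], then [A]
     would lie in the null set where [|g|] exceeds it. *)
  rewrite muT invey /= powRr0 mulr1; rewrite leNgt; apply/negP => h.
  have /= := ess_sup_ge mu (abse \o g).
  move=> [N [mN muN0 sN]].
  have AN : A `<=` N.
    move=> x Ax; apply: sN => /= le1.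
    by have := lt_le_trans h (le_trans (cg' _ Ax) le1); rewrite ltxx.
  have : (mu A <= mu N)%E by apply: le_measure; rewrite ?inE.
  by rewrite muN0 => /(le_trans mmu); rewrite lee_fin leNgt m0.
- have r0 : 0 < r by rewrite lee_fin in r1; exact: lt_le_trans r1.
  rewrite inver gt_eqF//=.
  have -> : ((c * m `^ r^-1)%:E = ((c `^ r)%:E * m%:E) `^ r^-1)%E.
    rewrite -EFinM poweR_EFin powRM ?powR_ge0 ?(ltW m0)// -powRrM mulfV ?gt_eqF//.
    by rewrite powRr1 ?ltW.
  apply: gt0_ler_poweR; rewrite ?invr_ge0 ?(ltW r0)// ?in_itv/= ?leey ?andbT//.
  + by rewrite mule_ge0// lee_fin ?powR_ge0 ?ltW.
  + by apply: integral_ge0 => x _; exact: poweR_ge0.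
  apply: (@le_trans _ _ ((c `^ r)%:E * mu A)%E).
    by rewrite lee_wpmul2l ?lee_fin ?powR_ge0.
  apply: ge0_integral_ge_cst; rewrite ?powR_ge0//; first by move=> x; exact: poweR_ge0.
  move=> x Ax; rewrite -poweR_EFin; apply: gt0_ler_poweR;
    rewrite ?(ltW r0) ?in_itv/= ?leey ?andbT ?lee_fin ?(ltW c0) ?abse_ge0//.
  exact: cg'.
Qed.

Lemma Lnorm_indic_le d (T : measurableType d) (R : realType)
    (mu : {measure set T -> \bar R}) (B : set T) (p : \bar R) (m : R) :
  (1 <= p)%E -> measurable B -> (mu B <= m%:E)%E ->
  ('N[mu]_p[EFin \o \1_B] <= (m `^ inv_exponent p)%:E)%E.
Proof.
move=> p1 mB mum; rewrite unlock /inv_exponent.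
case: p p1 => [r r1|_|//]; last first.
- rewrite invey /= powRr0; case: ifPn => [_|_]; last exact: lee01.
  apply/ess_supP; apply: nearW => x /=.
  by rewrite lee_fin indicE; case: (_ \in _); rewrite ?normr1 ?normr0.
- have r0 : 0 < r by rewrite lee_fin in r1; exact: lt_le_trans r1.
  rewrite inver gt_eqF//=.
  rewrite (eq_integral (fun x => (\1_B x)%:E)); last first.
    move=> x _; rewrite /= indicE; case: (_ \in _).
      by rewrite normr1 powR1.
    by rewrite normr0 powR0 ?gt_eqF.
  rewrite integral_indic// setIT -poweR_EFin.
  by apply: gt0_ler_poweR; rewrite ?invr_ge0 ?(ltW r0)// in_itv/= ?leey ?andbT
    ?measure_ge0// (le_trans _ mum).
Qed.

(** * Strips and tubes, and their measures *)

Definition strip {R : realType} (b s1 : R) (psi : R -> R) (s2 : R) :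
    set (measurableTypeR R * measurableTypeR R) :=
  [set y | `|y.1 - b| <= s1 /\ `|y.2 - psi y.1| <= s2].

(** The slice at height [u] is a strip whose centre [a u] and profile [phi u] move with [u].
    Constant, linear and curved profiles give the boxes, slanted rectangles and curve neighbourhoods
    of all the tests. *)
Definition tube {R : realType} (r0 : R) (a : R -> R) (r1 : R)
    (phi : R -> R -> R) (r2 : R) :
    set (measurableTypeR R * measurableTypeR R * measurableTypeR R) :=
  [set z | 1 <= z.2 <= 1 + r0 /\ strip (a z.2) r1 (phi z.2) r2 z.1].

Section strips.
Context {R : realType}.
Implicit Types (a b r s : R).

Lemma lebesgue_measure_itvcc a b : a <= b ->
  lebesgue_measure (`[a, b]%classic : set (measurableTypeR R)) = (b - a)%:E.
Proof.
move=> ab; rewrite lebesgue_measure_itv/= lte_fin.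
by case: ltgtP ab => // -> _; rewrite subrr.
Qed.

Lemma measurable_le_norm d (T : measurableType d) (f : T -> R) r :
  measurable_fun setT f -> measurable [set x | `|f x| <= r].
Proof.
move=> mf; rewrite (_ : [set x | _] = setT `&` f @^-1` `[- r, r]).
  by apply: mf => //; exact: measurable_itv.
by rewrite setTI; apply/seteqP; split=> x /=; rewrite in_itv/= ler_norml.
Qed.

Lemma measurable_strip b s1 (psi : R -> R) s2 :
  measurable_fun setT psi -> measurable (strip b s1 psi s2).
Proof.
move=> mpsi; apply: measurableI; apply: measurable_le_norm.
  by apply: measurable_funB => //; exact: measurable_fst.
apply: measurable_funB; first exact: measurable_snd.
by apply: measurableT_comp => //; exact: measurable_fst.
Qed.

(** By Fubini: each vertical section over [[b - s1, b + s1]] is an interval of length [2 * s2],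
    whatever [psi] is. *)
Lemma lebesgue2_strip b s1 (psi : R -> R) s2 : 0 <= s1 -> 0 <= s2 ->
  lebesgue2 (strip b s1 psi s2) = (4 * (s1 * s2))%:E.
Proof.
move=> s10 s20; rewrite /lebesgue2 /= /product_measure1.
rewrite (eq_integral (fun x : measurableTypeR R => (2 * s2)%:E * (\1_(`[b - s1, b + s1]) x)%:E)%E).
  rewrite ge0_integralZl ?lee_fin ?mulr_ge0//; last first.
    by apply/measurable_EFinP; apply: measurable_indic.
  rewrite integral_indic ?setIT//.
  rewrite [X in (_ * X)%E]lebesgue_measure_itvcc; last by lra.
  by rewrite -EFinM; congr EFin; ring.
move=> x _ /=; have [|] := boolP (x \in `[b - s1, b + s1]) => xI.
  rewrite indicE mem_set// mule1.
  transitivity (lebesgue_measure `[psi x - s2, psi x + s2]%classic).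
    congr lebesgue_measure; apply/seteqP; split => y; rewrite /xsection/= inE/=.
      by case=> _ /=; rewrite ler_distl in_itv.
    by rewrite in_itv/= -ler_distl => yI; split; rewrite //= ler_distl.
  by rewrite lebesgue_measure_itvcc; [congr EFin; ring | lra].
rewrite indicE memNset ?mulr0//; last exact/negP.
rewrite mule0 (_ : xsection _ _ = set0) ?measure0//.
apply/seteqP; split => y //; rewrite /xsection/= inE/= => -[/=].
by rewrite ler_distl => h; move: xI; rewrite in_itv/= h.
Qed.

Lemma measurable_tube r0 (a : R -> R) r1 (phi : R -> R -> R) r2 :
  measurable_fun setT a -> measurable_fun setT (fun z : R * R => phi z.1 z.2) ->
  measurable (tube r0 a r1 phi r2).
Proof.
move=> ma mphi; rewrite /tube /strip.
rewrite (_ : [set _ | _] =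
    (snd @^-1` `[1, 1 + r0]) `&`
    ([set z | `|z.1.1 - a z.2| <= r1] `&`
     [set z | `|z.1.2 - phi z.2 z.1.1| <= r2])); last first.
  by apply/seteqP; split=> z /=; rewrite in_itv.
apply: measurableI.
  by rewrite -[X in measurable X]setTI; apply: measurable_snd => //; exact: measurable_itv.
have m11 := measurableT_comp measurable_fst measurable_fst.
apply: measurableI; apply: measurable_le_norm; apply: measurable_funB.
- apply: measurableT_comp; exact: measurable_fst.
- by apply: measurableT_comp => //; exact: measurable_snd.
- apply: measurableT_comp; [exact: measurable_snd|exact: measurable_fst].
- apply: (measurableT_comp mphi (g := fun z => (z.2, z.1.1))).
  apply: measurable_fun_pair; first exact: measurable_snd.
  apply: measurableT_comp; exact: measurable_fst.
Qed.

(** The squares of an increasing exhaustion of the line by sets of finite measure exhaust the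
    plane. *)
Lemma sigma_finite_lebesgue2 :
  sigma_finite [set: measurableTypeR R * measurableTypeR R] lebesgue2.
Proof.
have /sigma_finiteP[G [TG ndG Goo]] := sigma_finiteT (@lebesgue_measure R).
exists (fun n => G n `*` G n).
  rewrite -setXTT TG predeqE => -[x y]; split.
    move=> [/= [n _ Gnx] [k _ Gky]]; exists (maxn n k) => //; split.
    - by move: x Gnx; exact/subsetPset/ndG/leq_maxl.
    - by move: y Gky; exact/subsetPset/ndG/leq_maxr.
  by move=> [n _ []/= ? ?]; split; exists n.
move=> k; have [mG Gk] := Goo k; split; first exact: measurableX.
by rewrite /lebesgue2/= product_measure1E// lte_mul_pinfty// ge0_fin_numE.
Qed.

(* The library's sigma-finite instance of [_ \x _] is shadowed by the one for
   subprobabilities, hence this named copy. *)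
Definition lebesgue2_sigma_finite :
  set (measurableTypeR R * measurableTypeR R) -> \bar R := lebesgue2.
HB.instance Definition _ := Measure.on lebesgue2_sigma_finite.
HB.instance Definition _ :=
  Measure_isSigmaFinite.Build _ _ _ lebesgue2_sigma_finite sigma_finite_lebesgue2.

(** Each slice at fixed [u] is a strip of area [4 * (r1 * r2)], and [r0 <= 1] keeps the tube inside
    [1 <= u <= 2]. *)
Lemma lebesgue_plane_itv12_tube r0 (a : R -> R) r1 (phi : R -> R -> R) r2 :
  measurable_fun setT a -> measurable_fun setT (fun z : R * R => phi z.1 z.2) ->
  0 <= r0 <= 1 -> 0 <= r1 -> 0 <= r2 ->
  lebesgue_plane_itv12 (tube r0 a r1 phi r2) = (4 * (r0 * r1 * r2))%:E.
Proof.
move=> ma mphi /andP[r00 r01] r10 r20; rewrite /lebesgue_plane_itv12 /= /mrestr.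
rewrite setIidl; last by move=> [x u] [/= u12 _]; split => //=; rewrite in_itv/=; lra.
have mt := measurable_tube r0 a r1 phi r2 ma mphi.
rewrite -[LHS]/((lebesgue2_sigma_finite \x @lebesgue_measure R)%E _).
(* The product measure as defined integrates over the plane the length of the sections in [u].
   Uniqueness of product measures swaps the order, so that the slices at fixed [u] appear. *)
rewrite (@product_measure_unique _ _
  (measurableTypeR R * measurableTypeR R)%type (measurableTypeR R) R
  lebesgue2_sigma_finite (@lebesgue_measure R)
  (lebesgue2_sigma_finite \x^ @lebesgue_measure R)%E)//; last first.
  by move=> A B mA mB; exact: product_measure2E.
transitivity (\int[@lebesgue_measure R]_u
    ((4 * (r1 * r2))%:E * (\1_(`[1, 1 + r0]) u)%:E))%E; last first.
  rewrite ge0_integralZl ?lee_fin ?mulr_ge0//; last first.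
    by apply/measurable_EFinP; apply: measurable_indic.
  rewrite integral_indic ?setIT//.
  rewrite [X in (_ * X)%E]lebesgue_measure_itvcc; last by lra.
  by rewrite -EFinM; congr EFin; ring.
apply: eq_integral => u _ /=; have [|] := boolP (u \in `[1, 1 + r0]) => uI.
  rewrite indicE mem_set// mule1 -(lebesgue2_strip (a u) r1 (phi u) r2)//.
  congr (_ _); apply/seteqP; split => y; rewrite /ysection/= inE.
    by case.
  by move=> ?; split => //=; rewrite in_itv in uI.
rewrite indicE memNset ?mulr0//; last exact/negP.
rewrite mule0 (_ : ysection _ _ = set0) ?measure0//.
apply/seteqP; split => y //; rewrite /ysection/= inE => -[/=].
by move=> h; move: uI; rewrite in_itv/= h.
Qed.

End strips.

(** * The inequality tested on the indicator of a strip *)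

Section strip_test.
Context {R : realType} (gamma : R -> R) (p q : \bar R) (C : R).
Hypotheses (p1 : (1 <= p)%E) (q1 : (1 <= q)%E).
Hypothesis TC : forall f : R * R -> R, f \in Lfun lebesgue2 p ->
  ('N[lebesgue_plane_itv12]_q[curve_average gamma f]
     <= C%:E * 'N[lebesgue2]_p[EFin \o f])%E.


(** For [(x, u)] in the tube the curve [x - u (t, gamma t)] stays in the strip during a time
    interval of length [l], so the average of the indicator is at least [l] there. The two powers
    come from the volume of the tube and the area of the strip. *)
Lemma strip_test (b s1 : R) (psi : R -> R) (s2 r0 : R) (a : R -> R) (r1 : R)
    (phi : R -> R -> R) (r2 l : R) :
  measurable_fun setT psi -> measurable_fun setT a ->
  measurable_fun setT (fun z : R * R => phi z.1 z.2) ->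
  0 <= C -> 0 <= s1 -> 0 <= s2 -> 0 < r0 <= 1 -> 0 < r1 -> 0 < r2 -> 0 < l ->
  (forall x1 x2 u, 1 <= u <= 1 + r0 ->
     `|x1 - a u| <= r1 -> `|x2 - phi u x1| <= r2 ->
     exists e, [/\ 0 <= e, e + l <= 1 & forall t, e < t <= e + l ->
       `|x1 - u * t - b| <= s1 /\
       `|x2 - u * gamma t - psi (x1 - u * t)| <= s2]) ->
  l * (4 * (r0 * r1 * r2)) `^ inv_exponent q <=
  C * (4 * (s1 * s2)) `^ inv_exponent p.
Proof.
move=> mpsi ma mphi C0 s10 s20 /andP[r00 r01] r10 r20 l0 H.
pose B := strip b s1 psi s2.
have mB : measurable B by exact: measurable_strip.
have normB : ('N[lebesgue2]_p[EFin \o \1_B] <=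
    ((4 * (s1 * s2)) `^ inv_exponent p)%:E)%E.
  by apply: Lnorm_indic_le => //; rewrite lebesgue2_strip.
have fB : (\1_B : R * R -> R) \in Lfun lebesgue2 p.
  rewrite inE; apply/andP; split; rewrite inE/=.
    exact: measurable_indic.
  by apply: le_lt_trans normB _; rewrite ltry.
have := TC _ fB; rewrite -lee_fin => TB.
rewrite [leRHS]EFinM.
apply: le_trans (_ : (_ <= C%:E * 'N[lebesgue2]_p[EFin \o \1_B])%E) _; last first.
  by apply: lee_wpmul2l; rewrite ?lee_fin.
apply: le_trans TB.
have mt := measurable_tube r0 a r1 phi r2 ma mphi.
apply: (Lnorm_ge_cst _ _ _ _ (tube r0 a r1 phi r2)) => //.
- by rewrite !mulr_gt0.
- by rewrite lebesgue_plane_itv12_tube ?(ltW r00) ?(ltW r10) ?(ltW r20) ?r01.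
move=> [[x1 x2] u] [/= u1 [/= xa xphi]].
have [e [e0 el1 He]] := H x1 x2 u u1 xa xphi.
(* The interval is open at [e], so that [e = 0] is admissible although the average runs over []0,
   1]]. *)
have le : (@lebesgue_measure R `]e, e + l]%classic = l%:E).
  rewrite lebesgue_measure_itv/= lte_fin ltrDl l0 -EFinD; congr EFin; ring.
rewrite -[leLHS]mul1e -le.
apply: ge0_integral_ge_cst => //.
- by move=> t /=; rewrite !in_itv/=; lra.
- move=> t /=; rewrite in_itv/= => /He[h1 h2].
  by rewrite indicE mem_set//.
Qed.

End strip_test.

(** * Derivatives, Taylor estimate and monotonicity *)

Section calculus.
Context {R : realType}.
Implicit Types (f g gamma : R -> R) (a b x s t M : R).

Lemma within_dnbhs_interior (D : set R) x : nbhs x D -> within D x^' = x^'.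
Proof.
move=> xD; apply/seteqP; split => A; rewrite /within/=; last first.
  by apply: filterS => y Ay _.
rewrite /dnbhs /within/= => h.
by apply: filterS2 xD h => y Dy + yx => /(_ yx)/(_ Dy).
Qed.

(** At an interior point the restriction to [D] is invisible; the substitution [y = h + x] then
    turns one difference quotient into the other. *)
Lemma is_derive_within (D : set R) f x :
  nbhs x D -> derivable_within D f x -> is_derive x 1 f (derive_within D f x).
Proof.
move=> xD; rewrite /derivable_within /derive_within within_dnbhs_interior//.
move=> /cvgP fl.
have {}fl : (h^-1 *: ((f \o shift x) (h *: 1) - f x) @[h --> 0^'])
    --> lim (diff_quot f x y @[y --> x^']).
  rewrite (_ : (fun h => _) = diff_quot f x \o shift x); last first.
    by apply/funext => h; rewrite /diff_quot /= addrK mulrC /GRing.scale/= mulr1.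
  apply: cvg_comp fl => A.
  rewrite /dnbhs/= /within/= => /nbhs_ballP[e /= e0 xeA].
  apply/nbhs_ballP; exists e => // h /=; rewrite /ball/= sub0r normrN => he h0.
  apply: xeA; first by rewrite /ball/= opprD addrCA subrr addr0 normrN.
  by rewrite -subr_eq0 addrK.
by split; [apply/cvgP; exact: fl|exact/cvg_lim].
Qed.

Lemma lipschitz_of_is_derive f (df : R -> R) a b M :
  (forall x, a <= x <= b -> is_derive x 1 f (df x)) ->
  (forall x, a <= x <= b -> `|df x| <= M) ->
  forall s t, a <= s <= b -> a <= t <= b -> `|f t - f s| <= M * `|t - s|.
Proof.
move=> fdf dfM s t; wlog st : s t / s <= t.
  move=> h sab tab; have [st|/ltW ts] := leP s t; first exact: h.
  by rewrite distrC (distrC t); exact: h.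
move=> /andP[sa sb] /andP[ta tb].
have [x||x] := @MVT_segment R f df s t st.
- by rewrite in_itv/= => xst; apply: fdf; lra.
- apply: derivable_within_continuous => x; rewrite in_itv/= => xst.
  by have [] := fdf x ltac:(lra).
rewrite in_itv/= => xst ->; rewrite normrM ler_wpM2r//.
by apply: dfM; lra.
Qed.

(** The mean value inequality is applied to [f x - df c * x] between [c] and [t], where its
    derivative is at most [M * |t - c|]. *)
Lemma taylor_of_is_derive f (df : R -> R) a b c M : 0 <= M ->
  (forall x, a <= x <= b -> is_derive x 1 f (df x)) ->
  a <= c <= b ->
  (forall x, a <= x <= b -> `|df x - df c| <= M * `|x - c|) ->
  forall t, a <= t <= b -> `|f t - f c - df c * (t - c)| <= M * `|t - c| ^+ 2.
Proof.
move=> M0 fdf cab dfM t tab.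
pose h (x : R) := f x - df c * x.
have hdh x : a <= x <= b -> is_derive x 1 h (df x - df c).
  move=> /fdf fx; rewrite (_ : h = f - (df c \*: id)) //; apply: is_derive_eq.
  by rewrite /GRing.scale/= mulr1.
have := @lipschitz_of_is_derive h (fun x => df x - df c) (Num.min c t)
  (Num.max c t) (M * `|t - c|) _ _ c t _ _.
rewrite /h /= expr2 mulrA (_ : _ - _ - _ = f t - f c - df c * (t - c)); last first.
  by ring.
apply.
- move=> x; rewrite ge_min le_max => xct; apply: hdh; lra.
- move=> x; rewrite ge_min le_max => xct; apply: le_trans (dfM x _) _; first lra.
  apply: ler_wpM2l => //; rewrite ler_norml.
  by have := ler_norm (t - c); have := ler_norm (c - t); rewrite distrC; lra.
- by rewrite ge_min le_max lexx.
- by rewrite ge_min le_max lexx !orbT.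
Qed.

(** The limit 0 at the origin fixes the sign: a nondecreasing [gamma] is nonnegative and a
    nonincreasing one is nonpositive. *)
Lemma normr_monotone_cvg0 gamma :
  ({in `]0, 1] &, {homo gamma : s t / s <= t}} \/
   {in `]0, 1] &, {homo gamma : s t /~ s <= t}}) ->
  gamma t @[t --> 0^'+] --> 0 ->
  {in `]0, 1] &, {homo (fun t => `|gamma t|) : s t / s <= t}}.
Proof.
move=> mono lim0.
have near_s (s : R) : s \in `]0, 1] -> \forall t \near 0^'+, t \in `]0, 1] /\ t <= s.
  rewrite in_itv/= => /andP[s0 s1]; near=> t.
  have t0 : 0 < t by near: t; exact: nbhs_right_gt.
  have ts : t <= s by near: t; exact: nbhs_right_le.
  by split=> //; rewrite in_itv/= t0 (le_trans ts).
move=> s t sI tI st; case: mono => mono.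
- have ge0 (r : R) : r \in `]0, 1] -> 0 <= gamma r.
    move=> rI; apply: (cvgr_to_le lim0).
    by apply: filterS (near_s r rI) => v [vI vr]; exact: mono.
  by rewrite !ger0_norm ?ge0//; exact: mono.
- have le0 (r : R) : r \in `]0, 1] -> gamma r <= 0.
    move=> rI; apply: (cvgr_to_ge lim0).
    by apply: filterS (near_s r rI) => v [vI vr]; exact: mono.
  by rewrite !ler0_norm ?le0// lerN2; exact: mono.
Unshelve. all: by end_near. Qed.

End calculus.

(** * Comparison of exponents as d tends to 0 *)

Section asymptotics.
Context {R : realType}.

Lemma powR_le_exponent (al be K d0 : R) : 0 < d0 ->
  (forall d, 0 < d <= d0 -> d `^ al <= K * d `^ be) -> be <= al.
Proof.
move=> d00 H; rewrite leNgt; apply/negP => ab.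
have K0 : 0 < K.
  have := H d0; rewrite d00 lexx => /(_ isT) h.
  have : 0 < K * d0 `^ be by apply: lt_le_trans h; exact: powR_gt0.
  by rewrite pmulr_lgt0// powR_gt0.
(* For [d = expR (- m)], the first entry gives [d <= d0]; the second gives
   [m * (be - al) >= |ln K| + 1], whereas the logarithm of the hypothesis gives
   [m * (be - al) <= ln K]. *)
pose m := Num.max (- ln d0) ((`|ln K| + 1) / (be - al)).
have /H : 0 < expR (- m) <= d0.
  rewrite expR_gt0/= -[leRHS]lnK ?posrE// ler_expR lerNl.
  by rewrite /m le_max lexx.
rewrite -ler_ln ?posrE ?powR_gt0 ?mulr_gt0 ?powR_gt0 ?expR_gt0//.
rewrite lnM ?posrE ?powR_gt0 ?expR_gt0// !ln_powR !expRK.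
have : (`|ln K| + 1) / (be - al) <= m by rewrite /m le_max lexx orbT.
rewrite ler_pdivrMr ?subr_gt0//.
have := ler_norm (ln K); nra.
Qed.

(** In the tests [c0 * d ^ k] is the lower bound of the average, [cA * d ^ m] the volume of the tube
    and [cB * d ^ n] the area of the strip. *)
Lemma exponent_comparison (k m n c0 cA cB C iq ip d0 : R) :
  0 < c0 -> 0 < cA -> 0 < cB -> 0 < d0 ->
  (forall d, 0 < d <= d0 ->
     c0 * d `^ k * (cA * d `^ m) `^ iq <= C * (cB * d `^ n) `^ ip) ->
  n * ip <= k + m * iq.
Proof.
move=> c00 cA0 cB0 d00 H.
have cq0 : 0 < c0 * cA `^ iq by rewrite mulr_gt0 ?powR_gt0.
apply: (@powR_le_exponent _ _ (C * cB `^ ip / (c0 * cA `^ iq)) d0) => // d dd0.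
have /andP[d_gt0 _] := dd0.
have := H d dd0.
rewrite !powRM ?powR_ge0 ?(ltW cA0) ?(ltW cB0)// -!powRrM => h.
rewrite mulrAC ler_pdivlMr// powRD; last by rewrite (gt_eqF d_gt0) implybT.
lra.
Qed.

End asymptotics.

(** * The five test sets *)

Section necessary_conditions.
Context {R : realType} (gamma : R -> R) (p q : \bar R) (C : R).
Hypotheses (p1 : (1 <= p)%E) (q1 : (1 <= q)%E) (C0 : 0 <= C).
Hypothesis TC : forall f : R * R -> R, f \in Lfun lebesgue2 p ->
  ('N[lebesgue_plane_itv12]_q[curve_average gamma f]
     <= C%:E * 'N[lebesgue2]_p[EFin \o f])%E.
Let ip := inv_exponent p.
Let iq := inv_exponent q.

(** Since [u <= 2], the displacement for [t <= e] is at most [2 * e] and [2 * |gamma e|], which the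
    factors 3 absorb. The inequality is kept at each scale, as [|gamma e|] need not be a power of
    [e]. *)
Lemma box_test (e : R) : 0 < e <= 1 -> gamma e != 0 ->
  (forall t, 0 < t <= e -> `|gamma t| <= `|gamma e|) ->
  e * (4 * (e * `|gamma e|)) `^ iq <= C * (36 * (e * `|gamma e|)) `^ ip.
Proof.
move=> /andP[e0 e1] ge0 He.
have g0 : 0 < `|gamma e| by rewrite normr_gt0.
have := @strip_test R gamma p q C p1 q1 TC 0 (3 * e) (cst 0) (3 * `|gamma e|) 1
  (cst 0) e (fun _ => cst 0) `|gamma e| e.
rewrite mul1r (_ : 4 * (3 * e * (3 * `|gamma e|)) = 36 * (e * `|gamma e|)); last by ring.
apply => //.
- by lra.
- by lra.
move=> x1 x2 u u12; rewrite /= !subr0 => x1e x2e; exists 0; split; rewrite ?add0r//.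
move=> t te /=; rewrite !subr0.
have h : `|u * gamma t| <= 2 * `|gamma e|.
  by rewrite normrM ler_pM// ?He// ger0_norm; lra.
split.
  apply: le_trans (ler_normB _ _) _; rewrite (ger0_norm (x := u * t)); nra.
by apply: le_trans (ler_normB _ _) _; lra.
Qed.

(** The side is [L = d^-1 >= 1], so the bounded displacement (at most 2 and [2 * G]) is absorbed by
    multiples of [d^-1]; both measures are of order [d ^ (-2)]. *)
Lemma large_box_condition (G : R) :
  (forall t, 0 < t <= 1 -> `|gamma t| <= G) -> iq <= ip.
Proof.
move=> HG.
have G0 : 0 <= G by apply: le_trans (HG 1 _) => //; lra.
suff : - 2 * ip <= 0 + - 2 * iq by lra.
apply: (@exponent_comparison _ _ _ _ 1 4 (4 * (3 * (1 + 2 * G))) C _ _ 1); rewrite ?ltr01//.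
  by lra.
move=> d /andP[d0 d1].
have dV : d `^ (- 2) = d^-1 * d^-1.
  by rewrite powR_invn ?ltW// expr2 invfM.
have dV1 : 1 <= d^-1 by rewrite invf_ge1.
have := @strip_test R gamma p q C p1 q1 TC 0 (3 * d^-1) (cst 0) ((1 + 2 * G) * d^-1) 1
  (cst 0) d^-1 (fun _ => cst 0) d^-1 1.
rewrite powRr0 !mul1r dV -/iq -/ip.
rewrite (_ : 4 * (3 * d^-1 * ((1 + 2 * G) * d^-1)) =
  4 * (3 * (1 + 2 * G)) * (d^-1 * d^-1)); last by ring.
apply => //; rewrite ?ltr01 ?invr_gt0//.
- by lra.
- by nra.
- by rewrite lexx.
move=> x1 x2 u u12; rewrite /= !subr0 => x1e x2e; exists 0; split; rewrite ?add0r//.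
move=> t te /=; rewrite !subr0.
have h : `|u * gamma t| <= 2 * G.
  by rewrite normrM ler_pM// ?HG// ger0_norm; lra.
split.
  apply: le_trans (ler_normB _ _) _; rewrite (ger0_norm (x := u * t)); nra.
by apply: le_trans (ler_normB _ _) _; nra.
Qed.

(** A point of the tube lies near [u (t0, gamma t0)] with [t0 = x1 / u], and during []t0 - d, t0]]
    the Lipschitz bound keeps [x - u (t, gamma t)] within a multiple of [d] of the origin. The range
    [1/2 <= x1 <= 3/4] places [t0] in [[1/4, 3/4]]. *)
Lemma small_ball_condition (gammaT : R -> R) (M : R) :
  0 <= M -> measurable_fun setT gammaT ->
  (forall t, 1 / 16 <= t <= 15 / 16 -> gammaT t = gamma t) ->
  (forall s t, 1 / 16 <= s <= 15 / 16 -> 1 / 16 <= t <= 15 / 16 ->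
     `|gamma t - gamma s| <= M * `|t - s|) ->
  2 * ip - 1 <= iq.
Proof.
move=> M0 mT HT HL.
suff : 2%:R * ip <= 1 + 1 * iq by lra.
apply: (@exponent_comparison _ _ _ _ 1 (1 / 2) (8 * (1 + 2 * M)) C _ _ (1 / 8)); try lra.
move=> d /andP[d0 d1]; rewrite powR_mulrn ?(ltW d0)// powRr1 ?(ltW d0)//.
(* The function [(Num.max 1 u)^-1] equals [u^-1] on the tube, and is monotone, hence measurable, on
   the whole line. *)
have mV : measurable_fun setT (fun u : R => (Num.max 1 u)^-1).
  apply: nonincreasing_measurable => // s t st.
  rewrite lef_pV2 ?posrE ?lt_max ?ltr01//.
  by rewrite ge_max !le_max lexx st orbT.
have mphi : measurable_fun setT
    (fun z : R * R => z.1 * gammaT (z.2 * (Num.max 1 z.1)^-1)).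
  apply: measurable_funM; first exact: measurable_fst.
  apply: measurableT_comp => //; apply: measurable_funM; first exact: measurable_snd.
  by apply: (measurableT_comp mV); exact: measurable_fst.
have := @strip_test R gamma p q C p1 q1 TC 0 (2 * d) (cst 0) ((1 + 2 * M) * d) 1
  (cst (5 / 8)) (1 / 8) (fun u x1 => u * gammaT (x1 * (Num.max 1 u)^-1)) d d.
rewrite (_ : 4 * (1 * (1 / 8) * d) = 1 / 2 * d); last by field.
rewrite (_ : 4 * (2 * d * ((1 + 2 * M) * d)) = 8 * (1 + 2 * M) * d ^+ 2); last by ring.
rewrite (mul1r d); apply => //.
- by lra.
- by nra.
- by rewrite ltr01 lexx.
move=> x1 x2 u u12; rewrite /= => x1b.
have -> : Num.max 1 u = u by apply/max_idPr; lra.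
set t0 := x1 * u^-1.
have x1E : x1 = u * t0 by rewrite /t0 mulrC divfK//; lra.
have t0b : 1 / 4 <= t0 <= 3 / 4.
  move: x1b; rewrite x1E ler_norml => /andP[h1 h2]; apply/andP; split; nra.
rewrite HT; last by lra.
move=> x2b; exists (t0 - d); split; [lra|lra|].
move=> t tb; rewrite !subr0.
have tt0 : `|t - t0| <= d by rewrite ler_norml; lra.
split.
  rewrite x1E -mulrBr normrM distrC ger0_norm; last by lra.
  have := normr_ge0 (t - t0); nra.
rewrite (_ : x2 - _ = (x2 - u * gamma t0) - u * (gamma t - gamma t0)); last by ring.
apply: le_trans (ler_normB _ _) _.
have hg : `|gamma t - gamma t0| <= M * d.
  by apply: le_trans (HL _ _ _ _) _; [lra|lra|rewrite ler_wpM2l].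
have : `|u * (gamma t - gamma t0)| <= 2 * (M * d).
  by rewrite normrM ler_pM// ger0_norm; lra.
lra.
Qed.

(** For [x] near 0 and [u] near 1, [x - u (t, gamma t)] is close to [- (t, gamma t)], so it follows
    the reflected curve for all [t] in []1/4, 3/4]]. The second-coordinate error is at most
    [d + G * d + 2 * M * d]. *)
Lemma curve_neighbourhood_condition (gammaT : R -> R) (G M : R) :
  0 <= M -> measurable_fun setT gammaT ->
  (forall t, 1 / 16 <= t <= 15 / 16 -> gammaT t = gamma t) ->
  (forall t, 0 < t <= 1 -> `|gamma t| <= G) ->
  (forall s t, 1 / 16 <= s <= 15 / 16 -> 1 / 16 <= t <= 15 / 16 ->
     `|gamma t - gamma s| <= M * `|t - s|) ->
  ip / 3 <= iq.
Proof.
move=> M0 mT HT HG HL.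
have G0 : 0 <= G by apply: le_trans (HG 1 _) => //; lra.
suff : 1 * ip <= 0 + 3%:R * iq by lra.
apply: (@exponent_comparison _ _ _ _ (1 / 2) 4 (2 * (1 + G + 2 * M)) C _ _ (1 / 16)); try lra.
move=> d /andP[d0 d1]; rewrite powR_mulrn ?(ltW d0)// powRr1 ?(ltW d0)// powRr0 mulr1.
have mpsi : measurable_fun setT (fun y : R => - gammaT (- y)).
  by apply: measurable_funN; apply: measurableT_comp => //; exact: oppr_measurable.
have := @strip_test R gamma p q C p1 q1 TC (- (1 / 2)) (1 / 2)
  (fun y => - gammaT (- y)) ((1 + G + 2 * M) * d) d
  (cst 0) d (fun _ => cst 0) d (1 / 2).
rewrite (_ : 4 * (d * d * d) = 4 * d ^+ 3); last by ring.
rewrite (_ : 4 * (1 / 2 * ((1 + G + 2 * M) * d)) = 2 * (1 + G + 2 * M) * d); last by field.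
apply => //.
- by nra.
- by lra.
move=> x1 x2 u u1; rewrite /= !subr0 ler_norml => /andP[xl xr] x2b.
exists (1 / 4); split; [lra|lra|] => t tb.
have utb : 0 <= (u - 1) * t <= d by nra.
have sb : 1 / 16 <= u * t - x1 <= 15 / 16 by lra.
split; first by rewrite ler_norml; lra.
rewrite opprB HT// opprK.
rewrite (_ : x2 - _ + _ = x2 - (u - 1) * gamma t - (gamma t - gamma (u * t - x1))); last by ring.
apply: le_trans (ler_normB _ _) _.
have h1 : `|gamma t - gamma (u * t - x1)| <= M * (2 * d).
  apply: le_trans (HL _ _ _ _) _ => //; first by lra.
  by rewrite ler_wpM2l// ler_norml; lra.
have h2 : `|(u - 1) * gamma t| <= d * G.
  by rewrite normrM ler_pM// ?HG// ?ger0_norm; lra.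
have := ler_normB x2 ((u - 1) * gamma t).
lra.
Qed.

(** For [t] within [d] of 1/2 the curve leaves its tangent by at most [M * d ^ 2], so it stays in a
    rectangle of slope [g1] and thickness of order [d ^ 2]. Translating by [u (1/2, gamma (1/2))]
    gives the tube. *)
Lemma tangent_rectangle_condition (g1 M : R) :
  0 <= M ->
  (forall t, 1 / 4 <= t <= 3 / 4 ->
     `|gamma t - gamma (1 / 2) - g1 * (t - 1 / 2)| <= M * `|t - 1 / 2| ^+ 2) ->
  ip - 1 / 3 <= iq.
Proof.
move=> M0 HT.
suff : 3%:R * ip <= 1 + 3%:R * iq by lra.
apply: (@exponent_comparison _ _ _ _ 1 4 (12 * (1 + 2 * M)) C _ _ (1 / 4)); try lra.
move=> d /andP[d0 d1]; rewrite !powR_mulrn ?(ltW d0)// powRr1 ?(ltW d0)//.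
have mlin (c : R) : measurable_fun setT (fun y : R => c * y) by exact: mulrl_measurable.
have mphi : measurable_fun setT
    (fun z : R * R => z.1 * gamma (1 / 2) + g1 * (z.2 - 1 / 2 * z.1)).
  apply: measurable_funD.
    by apply: measurable_funM; [exact: measurable_fst|exact: measurable_cst].
  apply: (measurableT_comp (mlin g1)); apply: measurable_funB; first exact: measurable_snd.
  apply: (measurableT_comp (mlin (1 / 2))); exact: measurable_fst.
have := @strip_test R gamma p q C p1 q1 TC 0 (3 * d) ( *%R g1)
  ((1 + 2 * M) * d ^+ 2) 1 ( *%R (1 / 2)) d
  (fun u x1 => u * gamma (1 / 2) + g1 * (x1 - 1 / 2 * u)) (d ^+ 2) d.
rewrite (_ : 4 * (1 * d * d ^+ 2) = 4 * d ^+ 3); last by ring.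
rewrite (_ : 4 * (3 * d * ((1 + 2 * M) * d ^+ 2)) = 12 * (1 + 2 * M) * d ^+ 3); last by ring.
rewrite (mul1r d); apply => //.
- by lra.
- by nra.
- by rewrite ltr01 lexx.
- by rewrite exprn_gt0.
move=> x1 x2 u u12 /=; rewrite ler_norml => /andP[xl xr] x2b.
exists (1 / 2); split; [lra|lra|] => t tb; rewrite !subr0.
split; first by rewrite ler_norml; nra.
rewrite (_ : x2 - _ - _ = (x2 - (u * gamma (1 / 2) + g1 * (x1 - 1 / 2 * u)))
   - u * (gamma t - gamma (1 / 2) - g1 * (t - 1 / 2))); last by field.
apply: le_trans (ler_normB _ _) _.
have ht : `|gamma t - gamma (1 / 2) - g1 * (t - 1 / 2)| <= M * d ^+ 2.
  apply: le_trans (HT _ _) _; first by lra.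
  by rewrite ler_wpM2l// ler_pXn2r ?nnegrE ?(ltW d0)// ler_norml; lra.
have : `|u * (gamma t - gamma (1 / 2) - g1 * (t - 1 / 2))| <= 2 * (M * d ^+ 2).
  by rewrite normrM ler_pM// ger0_norm; lra.
lra.
Qed.

End necessary_conditions.

(** * The condition on omega *)

Section growth_at_origin.
Context {R : realType}.

Lemma limf_esup_le_near (f : R -> \bar R) (F : set_system R) (V : set R) (y : \bar R) :
  F V -> (forall x, V x -> (f x <= y)%E) -> (limf_esup f F <= y)%E.
Proof.
move=> FV fy; rewrite limf_esupE.
apply: (@le_trans _ _ (ereal_sup (f @` V))).
  by apply: ereal_inf_lbound; exists V.
by apply: ge_ereal_sup => _ [x Vx <-]; exact: fy.
Qed.

(** Taking logarithms and dividing by [ln e < 0] bounds [ln |gamma e| / ln e] by [1 / (ip - iq) - 1]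
    up to an error that tends to 0 with [e]. *)
Lemma growth_condition (gamma : R -> R) (C iq ip : R) :
  0 < C -> iq <= ip ->
  (forall t, 0 < t <= 1 -> gamma t != 0) ->
  (forall e, 0 < e <= 1 ->
    e * (4 * (e * `|gamma e|)) `^ iq <= C * (36 * (e * `|gamma e|)) `^ ip) ->
  (0 <= 1 + (1 + limf_esup (fun t => (ln `|gamma t| / ln t)%:E) 0^'+)
            * (iq - ip)%:E)%E.
Proof.
move=> C0 iqp gne box; set om := limf_esup _ _.
(* When the exponents agree the product is 0 even for infinite [om], by the convention for 0 times
   infinity. *)
have [->|iqne] := eqVneq iq ip; first by rewrite subrr mule0 adde0.
have d0 : 0 < ip - iq by rewrite subr_gt0 lt_neqAle iqne.
have omle (eta : R) : 0 < eta -> (om <= ((1 + eta) / (ip - iq) - 1)%:E)%E.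
  move=> eta0.
  pose K := ln C + ip * ln 36 - iq * ln 4.
  (* [K] collects the constants left by the logarithms; [e <= e0] amounts to
     [|K| <= eta * (- ln e)]. *)
  pose e0 := expR (- (`|K| / eta)).
  apply: (limf_esup_le_near _ _ [set e | 0 < e < 1 /\ e <= e0]).
    near=> e; split.
      apply/andP; split; first by near: e; exact: nbhs_right_gt.
      by near: e; exact: nbhs_right_lt.
    by near: e; apply: nbhs_right_le; exact: expR_gt0.
  move=> e [/andP[e_gt0 e1] ee0]; rewrite lee_fin.
  have g0 : 0 < `|gamma e| by rewrite normr_gt0 gne// e_gt0 ltW.
  have lne : ln e < 0 by rewrite ln_lt0// e_gt0.
  have Ke : `|K| <= - ln e * eta.
    rewrite -ler_pdivrMr// lerNr -[leRHS]expRK ler_ln ?posrE ?expR_gt0//.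
  have := box e; rewrite e_gt0 (ltW e1) => /(_ isT).
  rewrite -ler_ln ?posrE ?mulr_gt0 ?powR_gt0 ?mulr_gt0//.
  rewrite !lnM ?posrE ?powR_gt0 ?mulr_gt0// !ln_powR !lnM ?posrE ?mulr_gt0// => h.
  rewrite ler_ndivrMr// -(ler_pM2l d0) mulrA mulrBr mulrC (mulrC (ip - iq)) divfK ?gt_eqF//.
  have := ler_norm K; rewrite /K; nra.
have := omle 1 ltr01; case: om omle => [r| |] omle //= _.
- rewrite -!EFinD lee_fin.
  rewrite -opprB mulrN subr_ge0; apply/ler_addgt0Pr => eta eta0.
  have := omle eta eta0; rewrite lee_fin lerBrDr ler_pdivlMr//; lra.
(* For [om = -oo] the product with the negative number [iq - ip] is [+oo]. *)
- by rewrite addeNy lt0_mulNye ?lte_fin ?subr_lt0 ?lt_neqAle ?iqne// addey.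
Unshelve. all: by end_near. Qed.

(** Away from the origin, this turns the scale-invariant bounds of hypothesis (b) into uniform
    bounds on the derivatives. *)
Lemma weighted_derivative_bound (t w g K G c : R) (j : nat) :
  0 < c -> c <= t -> g != 0 -> `|g| <= G -> `|t ^+ j * w / g| <= K ->
  `|w| <= K * G / c ^+ j.
Proof.
move=> c0 ct g0 gG; rewrite !normrM normfV ler_pdivrMr ?normr_gt0// => h.
rewrite ler_pdivlMr ?exprn_gt0// mulrC.
apply: (@le_trans _ _ (`|t ^+ j| * `|w|)).
  apply: ler_wpM2r => //; rewrite ger0_norm; last by rewrite exprn_ge0// (le_trans (ltW c0)).
  by apply: lerXn2r; rewrite ?nnegrE ?(ltW c0)// (le_trans (ltW c0)).
apply: (le_trans h); apply: ler_wpM2l => //.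
have : 0 <= K * `|g| by apply: le_trans h; rewrite mulr_ge0.
by rewrite pmulr_lge0// normr_gt0.
Qed.

End growth_at_origin.

(** * Assembly of the conditions *)

Theorem theorem1p2 (R : realType) :
  exists N0 : nat, forall N : nat, (N0 <= N)%N ->
  forall gamma : R -> R,
    Cn_on `]0, 1] N gamma ->
    ({in `]0, 1] &, {homo gamma : s t / s <= t}} \/
     {in `]0, 1] &, {homo gamma : s t /~ s <= t}}) ->
    gamma t @[t --> 0^'+] --> 0 ->
    (forall t, t \in `]0, 1] -> gamma t != 0) ->
    (forall j : nat, (1 <= j <= 2)%N ->
       exists2 C1 : R, 0 < C1 &
         forall t, t \in `]0, 1] ->
           C1 <= `|t ^+ j * derive_withinn `]0, 1] j gamma t / gamma t|) ->
    (forall j : nat, (1 <= j <= N)%N ->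
       exists2 C2 : R, 0 < C2 &
         forall t, t \in `]0, 1] ->
           `|t ^+ j * derive_withinn `]0, 1] j gamma t / gamma t| <= C2) ->
  let omega : \bar R := limf_esup (fun t => (ln `|gamma t| / ln t)%:E) 0^'+ in
  forall p q : \bar R, (1 <= p)%E -> (1 <= q)%E ->
    (exists2 C : R, 0 < C &
       forall f : R * R -> R, f \in Lfun lebesgue2 p ->
         ('N[lebesgue_plane_itv12]_q[curve_average gamma f]
            <= C%:E * 'N[lebesgue2]_p[EFin \o f])%E) ->
  let ip := inv_exponent p in
  let iq := inv_exponent q in
  [/\ (0 <= 1 + (1 + omega) * (iq - ip)%:E)%E,
      2 * ip - 1 <= iq <= ip,
      ip / 3 <= iq
    & ip - 1 / 3 <= iq].
Proof.
(* With two derivatives, the first gives the Lipschitz bound on [gamma] and the second the Taylor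
   estimate at 1/2. *)
exists 2%N => N N2 gamma [gdiff _] mono lim0 gne _ gbnd omega p q p1 q1 [C C0 TC] ip iq.
have in01 (t : R) : (t \in `]0, 1]) = (0 < t <= 1) by rewrite in_itv.
have abs_mono := normr_monotone_cvg0 _ mono lim0.
pose G : R := `|gamma 1|.
have HG (t : R) : 0 < t <= 1 -> `|gamma t| <= G.
  by move=> t01; apply: abs_mono; rewrite ?in01//; lra.
have nb (t : R) : 1 / 16 <= t <= 15 / 16 -> nbhs t (`]0, 1]%classic : set R).
  move=> tb; apply: (@filterS _ _ _ `]0, 1[%classic).
    by move=> x /=; rewrite !in_itv/= => /andP[-> /ltW].
  by apply: near_in_itvoo; rewrite in_itv/=; lra.
pose g1 := derive_within `]0, 1] gamma.
pose g2 := derive_within `]0, 1] g1.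
have dg (t : R) : 1 / 16 <= t <= 15 / 16 -> is_derive t 1 gamma (g1 t).
  move=> tb; apply: is_derive_within; first exact: nb.
  by apply: (gdiff 0%N (ltnW N2)); rewrite /= in_itv/=; lra.
have dg1 (t : R) : 1 / 16 <= t <= 15 / 16 -> is_derive t 1 g1 (g2 t).
  move=> tb; apply: is_derive_within; first exact: nb.
  by apply: (gdiff 1%N N2); rewrite /= in_itv/=; lra.
have bound j : (1 <= j <= N)%N -> exists2 M, 0 <= M & forall t, 1 / 16 <= t <= 15 / 16 ->
    `|derive_withinn `]0, 1] j gamma t| <= M.
  move=> /gbnd[K K0 HK]; exists (K * G / (1 / 16) ^+ j).
    apply: divr_ge0; last by apply: exprn_ge0; lra.
    by apply: mulr_ge0; [exact: ltW|exact: normr_ge0].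
  move=> t tb; have t01 : t \in `]0, 1] by rewrite in01; lra.
  apply: (@weighted_derivative_bound _ t _ (gamma t)); rewrite ?gne//; try lra.
    by apply: HG; lra.
  exact: HK.
have [M1 M10 HM1] := bound 1%N (ltnW N2).
have [M2 M20 HM2] := bound 2%N N2.
have lip := lipschitz_of_is_derive _ _ _ _ _ dg HM1.
have lip1 := lipschitz_of_is_derive _ _ _ _ _ dg1 HM2.
have tay := @taylor_of_is_derive R gamma g1 (1 / 16) (15 / 16) (1 / 2) M2 M20 dg.
(* The values of [gamma] outside []0, 1]] are arbitrary. Composing with [clamp] gives a function
   that is monotone, hence measurable, on the whole line and agrees with [gamma] on
   [[1/16, 15/16]]. *)
pose clamp (t : R) := Num.max (1 / 16) (Num.min (15 / 16) t).
have clampE (t : R) : 1 / 16 <= t <= 15 / 16 -> clamp t = t.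
  move=> /andP[ta tb]; rewrite /clamp.
  by have /min_idPr -> := tb; have /max_idPr -> := ta.
have clamp01 (t : R) : clamp t \in `]0, 1].
  by rewrite in01 /clamp lt_max ge_max ge_min; lra.
have clamp_mono : {homo clamp : s t / s <= t}.
  by move=> s t st; rewrite /clamp ge_max !le_max lexx/= le_min !ge_min lexx st !orbT.
have mT : measurable_fun setT (gamma \o clamp).
  case: mono => mono.
    by apply: nondecreasing_measurable => // s t st; apply: mono => //; exact: clamp_mono.
  by apply: nonincreasing_measurable => // s t st; apply: mono => //; exact: clamp_mono.
have HT (t : R) : 1 / 16 <= t <= 15 / 16 -> (gamma \o clamp) t = gamma t.
  by move=> tb; rewrite /= clampE.
have iqp : iq <= ip by apply: (@large_box_condition R gamma p q C p1 q1 (ltW C0) TC G).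
split.
- apply: (@growth_condition R gamma C) => // e e01.
  apply: (@box_test R gamma p q C p1 q1 (ltW C0) TC) => //.
    by rewrite gne// in01.
  by move=> t te; apply: abs_mono; rewrite ?in01//; lra.
- rewrite iqp andbT.
  exact: (@small_ball_condition R gamma p q C p1 q1 (ltW C0) TC (gamma \o clamp) M1).
- exact: (@curve_neighbourhood_condition R gamma p q C p1 q1 (ltW C0) TC (gamma \o clamp) G M1).
- apply: (@tangent_rectangle_condition R gamma p q C p1 q1 (ltW C0) TC (g1 (1 / 2)) M2) => //.
  move=> t tb; apply: tay; [lra| |lra] => x xb.
  by apply: lip1; lra.
Qed.
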